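(* Let $p_1,p_2,p_3,p_4\in\mathbb{R}[x,y,z,w]$ be $$p_1=x\left(\tfrac32x^2-(y^2+z^2+w^2)\right),\quad p_2=y\left(\tfrac32y^2-(x^2+z^2+w^2)\right),$$ $$p_3=z\left(\tfrac32z^2-(x^2+y^2+w^2)\right),\quad p_4=w\left(\tfrac32w^2-(x^2+y^2+z^2)\right),$$ and let $f=p_1^2+p_2^2+p_3^2+p_4^2$. Then the Gram spectrahedron of $f$ consists of a unique point, and hence $f$ admits a unique decomposition as a sum of squares of real polynomials modulo orthogonal transformations.
   Context: For a homogeneous polynomial $f$ of degree $2d$ with real coefficients in $n$ variables, let $v$ be the vector of all monomials of degree $d$ in these variables. The Gram spectrahedron of $f$ is the set of all real symmetric positive semidefinite matrices $Q$ with $f=v^{T}Qv$. Two sum of squares decompositions are the same modulo orthogonal transformations if they are related (after padding with zeros) by an orthogonal matrix acting on the vector of polynomials; equivalently, they define the same $Q$ in the Gram spectrahedron. Here $n=4$ and $d=3$. *)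

(* Defs.v *)
From mathcomp Require Import all_boot all_order all_algebra.
From mathcomp Require Import reals.
From mathcomp.multinomials Require Import mpoly.

Set Implicit Arguments.
Unset Strict Implicit.
Unset Printing Implicit Defensive.

Import Order.TTheory GRing.Theory Num.Theory.
Local Open Scope ring_scope.

Section Gram.
Variables (R : realType) (n d : nat).

Definition deg_monoms : {set 'X_{1..n < d.+1}} :=
  [set m : 'X_{1..n < d.+1} | mdeg m == d].

Definition monom_vec : 'cV[{mpoly R[n]}]_#|deg_monoms| :=
  \col_i 'X_[bmnm (enum_val i)].

Definition is_psd (k : nat) (Q : 'M[R]_k) : Prop :=
  forall u : 'cV[R]_k, 0 <= (u^T *m Q *m u) 0 0.

(* For f homogeneous of degree 2 * d. *)
Definition gram_spectrahedron (f : {mpoly R[n]}) (Q : 'M[R]_#|deg_monoms|) :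
    Prop :=
  [/\ Q^T = Q, is_psd Q
    & f = (monom_vec^T *m map_mx (@mpolyC n R) Q *m monom_vec) 0 0].

End Gram.

Section SumsOfSquares.
Variables (R : realType) (n : nat).

Definition sos_decomposition (f : {mpoly R[n]}) (s : seq {mpoly R[n]}) : Prop :=
  f = \sum_(g <- s) g ^+ 2.

(* When size s <= N, this is s padded with zeros to length N, since s`_i = 0
   for size s <= i. *)
Definition pad_vec (N : nat) (s : seq {mpoly R[n]}) : 'cV[{mpoly R[n]}]_N :=
  \col_i s`_i.

Definition orthogonal_equiv (s t : seq {mpoly R[n]}) : Prop :=
  exists N : nat, [/\ (size s <= N)%N, (size t <= N)%N
    & exists2 U : 'M[R]_N, U^T *m U = 1%:M
      & pad_vec N t = map_mx (@mpolyC n R) U *m pad_vec N s].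

Definition unique_sos_mod_orthogonal (f : {mpoly R[n]}) : Prop :=
  (exists s, sos_decomposition f s) /\
  (forall s t, sos_decomposition f s -> sos_decomposition f t ->
     orthogonal_equiv s t).

End SumsOfSquares.

Section Polynomials.
Variable R : realType.

(* The numerals are the elements of 'I_4. *)
Local Notation x := ('X_(0 : 'I_4) : {mpoly R[4]}).
Local Notation y := ('X_(1 : 'I_4) : {mpoly R[4]}).
Local Notation z := ('X_(2 : 'I_4) : {mpoly R[4]}).
Local Notation w := ('X_(3 : 'I_4) : {mpoly R[4]}).
Local Notation c := (3 / 2 : R).

Definition p1 : {mpoly R[4]} := x * (c *: x ^+ 2 - (y ^+ 2 + z ^+ 2 + w ^+ 2)).
Definition p2 : {mpoly R[4]} := y * (c *: y ^+ 2 - (x ^+ 2 + z ^+ 2 + w ^+ 2)).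
Definition p3 : {mpoly R[4]} := z * (c *: z ^+ 2 - (x ^+ 2 + y ^+ 2 + w ^+ 2)).
Definition p4 : {mpoly R[4]} := w * (c *: w ^+ 2 - (x ^+ 2 + y ^+ 2 + z ^+ 2)).

Definition sum_sq_p : {mpoly R[4]} := p1 ^+ 2 + p2 ^+ 2 + p3 ^+ 2 + p4 ^+ 2.

End Polynomials.

(* Main.v *)
Require Import Defs.
From mathcomp Require Import all_boot all_order all_algebra.
From mathcomp Require Import reals.
From mathcomp.multinomials Require Import mpoly.
From mathcomp Require Import ring lra.

(** Write [e_i] for the coordinate vectors of R^4 and [p_i] for the four cubics.
The forms [p_i] have no common zero, so uniqueness cannot come from the real
zeros of [f].  It comes from a linear functional on sextics that is
nonnegative on squares of cubics although it is not a sum of point evaluations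
with positive weights:
<<
  L(h) = avg h(1,±1,±1,±1) + 3 sum_(i<j) avg h(e_i ± e_j) - 2 sum_i h(e_i).
>>
Write a cubic form as
[g = sum_i a_i x_i^3 + sum_(i<>j) b_ij x_i x_j^2 + sum_l c_l prod_(j<>l) x_j].
Then [L(g^2)] is the sum of squares
[sum_i ((sum_j u_ij)^2 + 3 sum_j u_ij^2) + sum_l c_l^2], where
[u_ij = b_ij + (2/3) a_i] ([sep_cubic_sqr]).  So [L(g^2) >= 0], and equality
forces [b_ij = -(2/3) a_i] and [c = 0], which says exactly that [g] is the
combination of the [p_i] with coefficients [(2/3) a_i = (2/3) g(e_i)].

In particular [L(f) = 0].  If [f] is a sum of squares of polynomials [g_k], every
[g_k] is a cubic form (compare extremal monomials, [sos_summand_homog]), so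
[L(g_k^2) = 0] for all [k] and [g_k = sum_i A_ki p_i]
([sos_summand_pfam]).  Evaluating [f] at [e_i] and at [e_i + e_j] gives
[A^T A = 1] ([sos_pcoord_orthonormal]).

Both claims follow.  A positive semidefinite [Q] factors as [B^T B]
([psd_factor]), so a Gram matrix of [f] gives a decomposition with [B = A P], where
[P] holds the coefficients of the [p_i]; hence [Q = P^T A^T A P = P^T P].  Two
decompositions have coordinate matrices with orthonormal columns, and after
padding by four zeros an orthogonal matrix carries one to the other
([orthogonal_transport]). *)

Set Implicit Arguments.
Unset Strict Implicit.
Unset Printing Implicit Defensive.

Import Order.TTheory GRing.Theory Num.Theory.
Local Open Scope ring_scope.

(** * Positive semidefinite and orthogonal matrices *)

Section Linalg.
Variable R : realType.

Lemma psd_block_form (k : nat) (q : R) (r : 'rV[R]_k) (S : 'M[R]_k) (t : R)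
    (v : 'cV[R]_k) :
  is_psd (block_mx q%:M r r^T S : 'M_(1 + k)) ->
  0 <= q * t ^+ 2 + 2 * t * (r *m v) 0 0 + (v^T *m S *m v) 0 0.
Proof.
move=> /(_ (col_mx t%:M v)).
rewrite tr_col_mx mul_row_block mul_row_col tr_scalar_mx.
rewrite !mulmxDl !mul_scalar_mx !mul_mx_scalar -trmx_mul -!scalemxAl.
set u := r *m v; set s := _ *m S *m v.
by rewrite !mxE !eqxx /= !mulr1n; congr (0 <= _); ring.
Qed.

Lemma block_upper_gram (k : nat) (a : R) (r : 'rV[R]_k) (B : 'M[R]_k) :
  (block_mx a%:M r 0 B)^T *m block_mx a%:M r 0 B =
  block_mx (a ^+ 2)%:M (a *: r) (a *: r^T) (r^T *m r + B^T *m B).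
Proof.
rewrite tr_block_mx mulmx_block !trmx0 tr_scalar_mx !mul0mx !mulmx0 !addr0.
by rewrite -scalar_mxM -expr2 mul_scalar_mx mul_mx_scalar.
Qed.

(** Cholesky factorization, by induction on the size: the Schur complement
[S - q^-1 r^T r] of a positive semidefinite matrix is again positive
semidefinite.  When [q = 0] the row [r] vanishes too, so the convention
[0^-1 = 0] makes the same formula cover the degenerate case. *)
Lemma psd_factor (k : nat) (Q : 'M[R]_k) :
  Q^T = Q -> is_psd Q -> exists B : 'M[R]_k, Q = B^T *m B.
Proof.
elim: k Q => [|k IH] Q symQ psdQ.
  by exists 0; apply/matrixP => -[].
pose q := ulsubmx (Q : 'M_(1 + k)) 0 0.
pose r := ursubmx (Q : 'M_(1 + k)).
pose S := drsubmx (Q : 'M_(1 + k)).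
have EQ : Q = block_mx q%:M r r^T S.
  have rT : r^T = dlsubmx (Q : 'M_(1 + k)) by rewrite /r trmx_ursub symQ.
  by rewrite rT -mx11_scalar submxK.
have form t v := psd_block_form t v (eq_ind _ (@is_psd R k.+1) psdQ _ EQ).
have symS : S^T = S by rewrite /S trmx_drsub symQ.
clearbody q r S.
have q0 : 0 <= q.
  have := form 1 0; rewrite !mulmx0 !mxE; lra.
have r0 : q = 0 -> r = 0.
  move=> qE; set n2 := (r *m r^T) 0 0.
  have n2E : n2 = \sum_j r 0 j ^+ 2.
    by rewrite /n2 mxE; apply: eq_bigr => j _; rewrite mxE -expr2.
  have n2_ge0 : 0 <= n2 by rewrite n2E sumr_ge0 // => j _; exact: sqr_ge0.
  have n2_0 : n2 = 0.
    set e := (r *m S *m r^T) 0 0.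
    have h t : 0 <= 2 * t * n2 + e.
      by have := form t r^T; rewrite trmxK qE mul0r add0r.
    (* For [n2 != 0] this value of [t] makes the affine function equal to -1. *)
    have := h (- (1 + e) / (2 * n2)).
    have [-> //|n20] := eqVneq n2 0.
    suff -> : 2 * (- (1 + e) / (2 * n2)) * n2 + e = -1 by lra.
    by field.
  apply/rowP => j; rewrite mxE; apply/eqP; rewrite -sqrf_eq0.
  move: n2_0; rewrite n2E => /eqP.
  rewrite psumr_eq0 => [/allP/(_ j)|i _]; last exact: sqr_ge0.
  by rewrite mem_index_enum => /(_ isT).
have [] := IH (S - q^-1 *: (r^T *m r)).
- by rewrite linearB /= linearZ /= trmx_mul trmxK symS.
- move=> v.
  (* The first coordinate that minimizes the quadratic form over [v]. *)
  have := form (- q^-1 * (r *m v) 0 0) v.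
  rewrite mulmxBr mulmxBl -scalemxAr -scalemxAl mulmxA -trmx_mul.
  rewrite -[_ *m r *m v]mulmxA.
  set u := r *m v; set s := _ *m S *m v; set w := u^T *m u.
  have wE : w 0 0 = u 0 0 ^+ 2 by rewrite mxE big_ord1 mxE.
  have -> : (s - q^-1 *: w) 0 0 = s 0 0 - q^-1 * w 0 0.
    by move: s w {wE} => s w; rewrite !mxE.
  rewrite wE.
  have [qE|qn0] := eqVneq q 0.
    have -> : u 0 0 = 0 by rewrite /u (r0 qE) mul0mx mxE.
    rewrite qE; congr (0 <= _); ring.
  by congr (0 <= _); field.
move=> B SE.
exists (block_mx (Num.sqrt q)%:M ((Num.sqrt q)^-1 *: r) 0 B).
rewrite EQ; apply: eq_trans (esym (block_upper_gram _ _ _)).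
have -> : ((Num.sqrt q)^-1 *: r)^T = (Num.sqrt q)^-1 *: r^T by rewrite linearZ.
rewrite sqr_sqrtr // !scalerA -SE -scalemxAl -scalemxAr scalerA.
rewrite -expr2 exprVn sqr_sqrtr // addrC subrK.
have [qE|qn0] := eqVneq q 0; first by rewrite (r0 qE) !trmx0 !scaler0.
have sn0 : Num.sqrt q != 0 by rewrite sqrtr_eq0 -ltNge lt_neqAle eq_sym qn0.
by rewrite mulfV // !scale1r.
Qed.

(** With [D = A - B] one has [D^T D = 2], so [1 - D D^T] is an orthogonal
reflection through the orthogonal complement of the columns of [D]; it
exchanges the columns of [A] and [B]. *)
Lemma orthogonal_transport_disjoint (N k : nat) (A B : 'M[R]_(N, k)) :
  A^T *m A = 1%:M -> B^T *m B = 1%:M -> A^T *m B = 0 ->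
  exists2 U : 'M[R]_N, U^T *m U = 1%:M & U *m A = B.
Proof.
move=> AA BB AB.
have BA : B^T *m A = 0 by rewrite -[LHS]trmxK trmx_mul trmxK AB trmx0.
pose D := A - B.
have DA : D^T *m A = 1%:M by rewrite /D linearB /= mulmxBl AA BA subr0.
have DB : D^T *m B = - 1%:M by rewrite /D linearB /= mulmxBl AB BB sub0r.
have DD : D^T *m D = 2%:M.
  by rewrite {2}/D mulmxBr DA DB opprK -raddfD.
exists (1%:M - D *m D^T).
  set P := D *m D^T.
  have PT : (1%:M - P)^T = 1%:M - P.
    by rewrite linearB /= trmx1 /P trmx_mul trmxK.
  have PP : P *m P = P + P.
    rewrite /P mulmxA -(mulmxA D) DD mul_mx_scalar -scalemxAl.
    by rewrite scaler_nat mulr2n.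
  rewrite PT mulmxBl mul1mx mulmxBr mulmx1 PP opprB.
  by rewrite addrK subrK.
by rewrite mulmxBl mul1mx -mulmxA DA mulmx1 /D opprB addrC subrK.
Qed.

(** The [k] rows of padding make room for a third orthonormal family [C],
orthogonal to both [A] and [B]; one reflection carries [A] to [C] and a second
carries [C] to [B]. *)
Lemma orthogonal_transport (n k : nat) (A B : 'M[R]_(n, k)) :
  A^T *m A = 1%:M -> B^T *m B = 1%:M ->
  exists2 U : 'M[R]_(n + k), U^T *m U = 1%:M &
    U *m col_mx A 0 = col_mx B 0.
Proof.
move=> AA BB.
pose C : 'M[R]_(n + k, k) := col_mx 0 1%:M.
have CC : C^T *m C = 1%:M by rewrite tr_col_mx mul_row_col mulmx0 trmx1 mul1mx add0r.
have E0 (X : 'M[R]_(n, k)) : X^T *m X = 1%:M ->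
    (col_mx X 0)^T *m col_mx X (0 : 'M_k) = 1%:M /\ (col_mx X 0)^T *m C = 0.
  by move=> XX; rewrite !tr_col_mx !mul_row_col XX !trmx0 !mulmx0 mul0mx !addr0.
have [AA' AC] := E0 A AA; have [BB' BC] := E0 B BB.
have CB : C^T *m col_mx B 0 = 0 by rewrite -[LHS]trmxK trmx_mul trmxK BC trmx0.
have [U UU UA] := orthogonal_transport_disjoint AA' CC AC.
have [V VV VC] := orthogonal_transport_disjoint CC BB' CB.
exists (V *m U); last by rewrite -mulmxA UA.
by rewrite trmx_mul mulmxA -(mulmxA U^T) VV mulmx1.
Qed.

End Linalg.

(** * Homogeneity of the summands of a sum of squares *)

Section Homog.
Variables (R : realType) (n : nat).
Implicit Types (g f : {mpoly R[n]}) (s : seq {mpoly R[n]}).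

(** The case in mind is a vertex [m] of the Newton polytope of [g]: then [m + m]
is the only way to write [2 m] as a sum of two monomials of [g]. *)
Lemma mcoeff_sqr_extremal g (m : 'X_{1..n}) :
  (forall a b, a \in msupp g -> b \in msupp g -> (a + b = m + m)%MM -> a = m) ->
  (g ^+ 2)@_(m + m) = g@_m ^+ 2.
Proof.
move=> ext; rewrite expr2 mcoeffM.
have lem : (mdeg m < (mdeg (m + m)).+1)%N by rewrite mdegD ltnS leq_addr.
rewrite (bigD1 (BMultinom lem, BMultinom lem)) //= big1 ?addr0 ?expr2 //.
move=> [a b] /= /andP[/eqP ab neq]; apply/eqP; apply: contraNT neq.
rewrite mulf_eq0 negb_or -!mcoeff_msupp => /andP[sa sb].
have am : a = m :> 'X_{1..n} by exact: ext sa sb _.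
have bm : b = m :> 'X_{1..n} by apply: ext sb sa _; rewrite addmC.
by apply/eqP; congr pair; apply: val_inj.
Qed.

Lemma exists_greatest (T : eqType) (le : rel T) (s : seq T) (x : T) :
  total le -> transitive le -> x \in s ->
  exists2 m, m \in s & {in s, forall y, le y m}.
Proof.
move=> le_total le_trans; elim: s x => // y s IH x _.
have [->|[z zs]] : s = [::] \/ exists z, z \in s.
  by case: (s) => [|z s']; [left | right; exists z; rewrite mem_head].
  exists y; rewrite ?mem_head // => z; rewrite inE => /eqP ->.
  by have := le_total y y; rewrite orbb.
have [m ms mmax] := IH z zs.
have [ym|my] := orP (le_total y m).
  exists m; first by rewrite inE ms orbT.
  by move=> t; rewrite inE => /orP[/eqP -> //|/mmax].
exists y; rewrite ?mem_head // => t; rewrite inE => /orP[/eqP ->|/mmax tm].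
  by have := le_total y y; rewrite orbb.
exact: le_trans my.
Qed.

(** Let [m] be the greatest monomial that occurs in any summand.  The coefficient
of [2 m] in [f] is a sum of squares that are not all zero, so [2 m] occurs in
[f] and [m] has degree [d].  Stated for an abstract order, so as to be applied
to the graded order of monomials and to its converse. *)
Lemma sos_extremal_mdeg (le : rel 'X_{1..n}) d f s :
  total le -> transitive le ->
  (forall a b m, le a m -> le b m -> (a + b = m + m)%MM -> a = m) ->
  f \is (2 * d)%N.-homog -> sos_decomposition f s ->
  forall g a, g \in s -> a \in msupp g -> exists2 m, mdeg m = d & le a m.
Proof.
move=> leT leTr le_strict fhom fE g a gs ag.
pose S := flatten [seq (msupp h : seq 'X_{1..n}) | h <- s].
have inS h b : h \in s -> b \in msupp h -> b \in S.
  by move=> hs bh; apply/flatten_mapP; exists h.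
have [m mS mmax] := exists_greatest leT leTr (inS g a gs ag).
exists m; last exact/mmax/inS/ag.
have [h hs mh] := flatten_mapP mS.
have fm : f@_(m + m) = \sum_(k <- s) k@_m ^+ 2.
  rewrite fE raddf_sum /=; apply: eq_big_seq => k ks.
  apply: mcoeff_sqr_extremal => b c bk ck.
  by apply: le_strict; apply: mmax; exact: inS ks _.
have : f@_(m + m) != 0.
  rewrite fm psumr_eq0 => [|k _]; last exact: sqr_ge0.
  apply/allPn; exists h => //=; by rewrite sqrf_eq0 -mcoeff_msupp.
rewrite -mcoeff_msupp => /(dhomog_mf fhom).
by rewrite /= mdegD addnn -mul2n => /eqP; rewrite eqn_pmul2l // => /eqP.
Qed.

Lemma sos_summand_homog d f s :
  f \is (2 * d)%N.-homog -> sos_decomposition f s ->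
  {in s, forall g, g \is d.-homog}.
Proof.
move=> fhom fE g gs; apply/dhomogP => a ag /=.
have [| | |m md am] := @sos_extremal_mdeg <=%O d f s _ _ _ fhom fE g a gs ag.
- exact: le_total.
- exact: le_trans.
- move=> x y z; rewrite le_eqVlt => /orP[/eqP //|xz yz E].
  by have := ltmc_le_add xz yz; rewrite E ltxx.
have [| | |k kd ka] := @sos_extremal_mdeg >=%O d f s _ _ _ fhom fE g a gs ag.
- by move=> x y; exact: le_total.
- by move=> x y z xy yz; exact: le_trans yz xy.
- move=> x y z; rewrite /= le_eqVlt => /orP[/eqP //|xz yz E].
  by have := ltmc_le_add xz yz; rewrite E ltxx.
by apply/eqP; rewrite eqn_leq -{1}md lemc_mdeg //= -kd lemc_mdeg.
Qed.

Lemma dhomog0E g : g \is 0.-homog -> g = (g@_0)%:MP.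
Proof.
move=> ghom; apply/mpolyP => m; rewrite mcoeffC.
have [->|m0] := eqVneq m 0%MM; first by rewrite mulr1.
by rewrite mulr0 (dhomog_nemf_coeff ghom) //= mdeg_eq0.
Qed.

Lemma dhomogS_split d g : g \is d.+1.-homog ->
  exists2 h : 'I_n -> {mpoly R[n]},
    (forall i, h i \is d.-homog) & g = \sum_i 'X_i * h i.
Proof.
move=> ghom; rewrite [g]mpolyE big_seq.
apply: (big_ind (fun p : {mpoly R[n]} => exists2 h : 'I_n -> {mpoly R[n]},
    (forall i, h i \is d.-homog) & p = \sum_i 'X_i * h i)).
- exists (fun=> 0) => [i|]; first exact: rpred0.
  by rewrite big1 // => i _; rewrite mulr0.
- move=> p q [h hh ->] [k kh ->]; exists (fun i => h i + k i) => [i|].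
    by rewrite rpredD.
  by rewrite -big_split; apply: eq_bigr => i _; rewrite mulrDr.
move=> m /(dhomog_mf ghom) /= mdeg_m.
have [i mi] : exists i, m i != 0%N.
  apply/existsP; apply: contraT; rewrite negb_exists => /forallP m0.
  move: mdeg_m; rewrite mdegE big1 // => i _.
  by apply/eqP; have := m0 i; rewrite negbK.
have Um : (U_(i) <= m)%MM.
  by apply/mnm_lepP => j; rewrite mnm1E; case: eqP => // <-; rewrite lt0n.
exists (fun j => if j == i then g@_m *: 'X_[m - U_(i)] else 0) => [j|].
  case: eqP => _; last exact: rpred0.
  apply: rpredZ; rewrite dhomogX /=; apply/eqP/(@addIn 1%N).
  by rewrite -{1}(mdeg1 i) -mdegD submK // mdeg_m addn1.
rewrite (bigD1 i) //= eqxx big1 => [|j /negPf ->]; last by rewrite mulr0.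
by rewrite addr0 -scalerAr -mpolyXD addmC submK.
Qed.

End Homog.

(** * Cubic forms in four variables *)

Lemma sum_I4 (V : nmodType) (F : 'I_4 -> V) : \sum_i F i = F 0 + F 1 + F 2 + F 3.
Proof.
rewrite !big_ord_recl big_ord0 addr0 !addrA.
by congr (F _ + F _ + F _ + F _); apply: val_inj.
Qed.

Lemma prod_I4 (V : comPzRingType) (F : 'I_4 -> V) :
  \prod_i F i = F 0 * F 1 * F 2 * F 3.
Proof.
rewrite !big_ord_recl big_ord0 mulr1 !mulrA.
by congr (F _ * F _ * F _ * F _); apply: val_inj.
Qed.

Section Cubic.
Variable R : realType.
Implicit Types (g f : {mpoly R[4]}) (s : seq {mpoly R[4]}).
Implicit Types (a c : 'I_4 -> R) (b : 'I_4 -> 'I_4 -> R).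

(** General cubic form in four variables, with the 20 coefficients indexed by
symmetry type. *)
Definition cubic a b c : {mpoly R[4]} :=
  \sum_i 'X_i * ((a i)%:MP * 'X_i ^+ 2 + \sum_(j | j != i) (b i j)%:MP * 'X_j ^+ 2)
  + \sum_i (c i)%:MP * \prod_(j | j != i) 'X_j.

(** Splitting off a variable three times writes [g] as a sum of
[T i j k x_i x_j x_k]; the coefficients of equal monomials are then collected. *)
Lemma dhomog3_cubic g : g \is 3.-homog -> exists a b c, g = cubic a b c.
Proof.
move=> /dhomogS_split[h1 hom1 ->].
have /fin_all_exists[h2 /all_and2[hom2 E1]] : forall i, exists h : 'I_4 -> {mpoly R[4]},
    (forall j, h j \is 1.-homog) /\ h1 i = \sum_j 'X_j * h j.
  by move=> i; have [h] := dhomogS_split (hom1 i); exists h.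
have /fin_all_exists[h3 H3] : forall i, exists h : 'I_4 -> 'I_4 -> {mpoly R[4]},
    forall j, (forall k, h j k \is 0.-homog) /\ h2 i j = \sum_k 'X_k * h j k.
  move=> i.
  have /fin_all_exists[h hP] : forall j, exists h : 'I_4 -> {mpoly R[4]},
      (forall k, h k \is 0.-homog) /\ h2 i j = \sum_k 'X_k * h k.
    by move=> j; have [h] := dhomogS_split (hom2 i j); exists h.
  by exists h.
pose T i j k := (h3 i j k)@_0.
have E3 i j k : h3 i j k = (T i j k)%:MP by exact/dhomog0E/(H3 i j).1.
have -> : \sum_i 'X_i * h1 i =
    \sum_i \sum_j \sum_k (T i j k)%:MP * 'X_i * 'X_j * 'X_k.
  apply: eq_bigr => i _; rewrite E1 mulr_sumr; apply: eq_bigr => j _.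
  rewrite (H3 i j).2 !mulr_sumr; apply: eq_bigr => k _.
  rewrite E3; ring.
exists (fun i => T i i i), (fun i j => T i j j + T j i j + T j j i),
  (* A product of three distinct variables is indexed by the missing one, [l]. *)
  (fun l => \sum_i \sum_j \sum_k if uniq [:: l; i; j; k] then T i j k else 0).
rewrite /cubic.
under [X in _ = X + _]eq_bigr do rewrite big_mkcond.
under [X in _ = _ + X]eq_bigr do rewrite [\prod_(_ | _) _]big_mkcond /=.
rewrite !sum_I4 /= !prod_I4 /= !addr0 !add0r.
rewrite !mpolyCD.
ring.
Qed.

Lemma meval_cubic a b c (v : 'I_4 -> R) :
  (cubic a b c).@[v] =
    \sum_i v i * (a i * v i ^+ 2 + \sum_(j | j != i) b i j * v j ^+ 2)
    + \sum_i c i * \prod_(j | j != i) v j.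
Proof.
rewrite mevalD !raddf_sum /=; congr (_ + _); apply: eq_bigr => i _.
  rewrite mevalM mevalXU mevalD mevalM mevalC rmorphXn /= mevalXU raddf_sum /=.
  congr (_ * (_ + _)); apply: eq_bigr => j _.
  by rewrite mevalM mevalC rmorphXn /= mevalXU.
rewrite mevalM mevalC rmorph_prod /=; congr (_ * _); apply: eq_bigr => j _.
by rewrite mevalXU.
Qed.

(** The four cubics as one family, which makes their symmetry usable. *)
Definition pfam (i : 'I_4) : {mpoly R[4]} :=
  'X_i * ((3 / 2) *: 'X_i ^+ 2 - \sum_(j | j != i) 'X_j ^+ 2).

Lemma sum_sq_pE : sum_sq_p R = \sum_i pfam i ^+ 2.
Proof.
rewrite /sum_sq_p /p1 /p2 /p3 /p4 /pfam.
under eq_bigr do rewrite big_mkcond /=.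
by rewrite !sum_I4 /= !addr0 !add0r.
Qed.

Lemma meval_pfam i (v : 'I_4 -> R) :
  (pfam i).@[v] = v i * (3 / 2 * v i ^+ 2 - \sum_(j | j != i) v j ^+ 2).
Proof.
rewrite mevalM mevalXU mevalB mevalZ rmorphXn /= mevalXU [meval _ _]raddf_sum /=.
congr (_ * (_ - _)); apply: eq_bigr => j _.
by rewrite rmorphXn /= mevalXU.
Qed.

(** The kernel of the form [g |-> sep (g^2)] in coordinates: a cubic is a
combination of the [pfam i] as soon as [b i j = - (2 / 3) * a i] and [c = 0]. *)
Lemma cubic_pfam (k : 'I_4 -> R) :
  cubic (fun i => 3 / 2 * k i) (fun i _ => - k i) (fun=> 0) =
  \sum_i k i *: pfam i.
Proof.
rewrite /cubic [X in _ + X]big1 => [|i _]; last by rewrite mul0r.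
rewrite addr0; apply: eq_bigr => i _.
rewrite /pfam scalerAr; congr (_ * _).
rewrite scalerBr scalerA mul_mpolyC [k i * _]mulrC; congr (_ + _).
rewrite scaler_sumr -sumrN; apply: eq_bigr => j _.
by rewrite mul_mpolyC scaleNr.
Qed.

Definition pt (x y z w : R) : 'I_4 -> R := fun i => [:: x; y; z; w]`_i.

(** The functional [L] that supports the cone of sums of squares at [f].  On the even monomials x^6, x^4 y^2,
x^2 y^2 z^2 it takes the values 8, 4, 1, and it vanishes on the other sextic
monomials: up to scale, the only functional invariant under permutations and
sign changes of the variables that kills all multiples of the [pfam i].
Antipodal points agree on even forms, so half of the sign vectors suffice. *)
Definition sep f : R :=
    8^-1 * \sum_(v <- [:: pt 1 1 1 1; pt 1 1 1 (-1); pt 1 1 (-1) 1;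
                          pt 1 1 (-1) (-1); pt 1 (-1) 1 1; pt 1 (-1) 1 (-1);
                          pt 1 (-1) (-1) 1; pt 1 (-1) (-1) (-1)]) f.@[v]
  + 3 / 2 * \sum_(v <- [:: pt 1 1 0 0; pt 1 (-1) 0 0; pt 1 0 1 0;
                          pt 1 0 (-1) 0; pt 1 0 0 1; pt 1 0 0 (-1);
                          pt 0 1 1 0; pt 0 1 (-1) 0; pt 0 1 0 1;
                          pt 0 1 0 (-1); pt 0 0 1 1; pt 0 0 1 (-1)]) f.@[v]
  - 2 * \sum_(v <- [:: pt 1 0 0 0; pt 0 1 0 0; pt 0 0 1 0; pt 0 0 0 1]) f.@[v].

(** The identity behind the proof: it exhibits [sep] as nonnegative on squares of
cubics in spite of the negative weights at the coordinate vectors. *)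
Lemma sep_cubic_sqr a b c (u := fun i j => b i j + 2 / 3 * a i) :
  sep (cubic a b c ^+ 2) =
  \sum_i ((\sum_(j | j != i) u i j) ^+ 2 + 3 * \sum_(j | j != i) u i j ^+ 2)
  + \sum_i c i ^+ 2.
Proof.
have E v : (cubic a b c ^+ 2).@[v] =
    (\sum_i v i * (a i * v i ^+ 2 + \sum_j if j != i then b i j * v j ^+ 2 else 0)
    + \sum_i c i * \prod_j if j != i then v j else 1) ^+ 2.
  rewrite rmorphXn /= meval_cubic; congr ((_ + _) ^+ 2); apply: eq_bigr => i _.
    by rewrite big_mkcond.
  by rewrite big_mkcond.
have -> : \sum_i ((\sum_(j | j != i) u i j) ^+ 2 + 3 * \sum_(j | j != i) u i j ^+ 2) =
  \sum_i ((\sum_j if j != i then u i j else 0) ^+ 2 +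
          3 * \sum_j if j != i then u i j ^+ 2 else 0).
  by apply: eq_bigr => i _; rewrite -!big_mkcond.
rewrite /sep !big_cons !big_nil !E {E}.
rewrite !sum_I4 /= !prod_I4 /= /pt /= /u.
by field.
Qed.

Lemma sep_sum (I : Type) (r : seq I) (F : I -> {mpoly R[4]}) :
  sep (\sum_(i <- r) F i) = \sum_(i <- r) sep (F i).
Proof.
have sepD f g : sep (f + g) = sep f + sep g.
  have E (r' : seq ('I_4 -> R)) : \sum_(v <- r') (f + g).@[v] =
      \sum_(v <- r') f.@[v] + \sum_(v <- r') g.@[v].
    by rewrite -big_split; apply: eq_bigr => v _; rewrite mevalD.
  rewrite /sep !E; ring.
have sep0 : sep 0 = 0 :> R.
  by rewrite /sep !big1 => [|v _|v _|v _]; rewrite ?meval0 // !mulr0 addr0 subr0.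
exact: (big_morph _ sepD sep0).
Qed.

Lemma sep_sqr_pfam (k : 'I_4 -> R) : sep ((\sum_i k i *: pfam i) ^+ 2) = 0.
Proof.
rewrite -cubic_pfam sep_cubic_sqr [X in _ + X]big1 => [|i _]; last first.
  by rewrite expr0n.
rewrite addr0 big1 // => i _.
have u0 : - k i + 2 / 3 * (3 / 2 * k i) = 0 by field.
by rewrite !big1 => [|j _|j _]; rewrite ?u0 ?expr0n ?mulr0 ?addr0.
Qed.

Lemma pfamE i : pfam i = \sum_j (j == i)%:R *: pfam j.
Proof.
rewrite (bigD1 i) //= eqxx scale1r big1 ?addr0 // => j /negPf ->.
exact: scale0r.
Qed.

Lemma sep_sum_sq_p : sep (sum_sq_p R) = 0.
Proof.
rewrite sum_sq_pE sep_sum big1 // => i _.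
by rewrite pfamE sep_sqr_pfam.
Qed.

Lemma sep_sqr_ge0 g : g \is 3.-homog -> 0 <= sep (g ^+ 2).
Proof.
move=> /dhomog3_cubic[a [b [c ->]]]; rewrite sep_cubic_sqr.
apply: addr_ge0; apply: sumr_ge0 => i _; last exact: sqr_ge0.
apply: addr_ge0; first exact: sqr_ge0.
by apply: mulr_ge0; rewrite ?ler0n // sumr_ge0 // => j _; exact: sqr_ge0.
Qed.

Lemma sep_sqr_eq0 g : g \is 3.-homog -> sep (g ^+ 2) = 0 ->
  exists k : 'I_4 -> R, g = \sum_i k i *: pfam i.
Proof.
move=> /dhomog3_cubic[a [b [c ->]]]; rewrite sep_cubic_sqr => /eqP.
have ge i : 0 <= \sum_(j | j != i) (b i j + 2 / 3 * a i) ^+ 2.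
  by apply: sumr_ge0 => j _; exact: sqr_ge0.
have ge' i : 0 <= (\sum_(j | j != i) (b i j + 2 / 3 * a i)) ^+ 2 +
    3 * \sum_(j | j != i) (b i j + 2 / 3 * a i) ^+ 2.
  by apply: addr_ge0; [exact: sqr_ge0 | apply: mulr_ge0; rewrite ?ler0n].
rewrite paddr_eq0; [|by apply: sumr_ge0|by apply: sumr_ge0 => i _; exact: sqr_ge0].
rewrite !psumr_eq0; [|by move=> i _; exact: sqr_ge0|by []].
move=> /andP[/allP u0 /allP c0]; exists (fun i => 2 / 3 * a i).
rewrite -cubic_pfam /cubic; congr (_ + _); apply: eq_bigr => i _; last first.
  have := c0 i; rewrite mem_index_enum => /(_ isT).
  by rewrite sqrf_eq0 => /eqP ->.
have -> : 3 / 2 * (2 / 3 * a i) = a i by field.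
congr (_ * (_ + _)); apply: eq_bigr => j ji; congr (_%:MP * _).
have := u0 i; rewrite mem_index_enum => /(_ isT) /=.
rewrite paddr_eq0 ?sqr_ge0 ?mulr_ge0 ?ler0n // => /andP[_].
rewrite mulf_eq0 pnatr_eq0 /= psumr_eq0 => [|l _]; last exact: sqr_ge0.
move=> /allP/(_ j); rewrite mem_index_enum ji => /(_ isT) /=.
by rewrite sqrf_eq0 addr_eq0 => /eqP ->.
Qed.

Definition axis (i : 'I_4) : 'I_4 -> R := fun k => (k == i)%:R.

Lemma meval_pfam_axis i k : (pfam k).@[axis i] = 3 / 2 * (k == i)%:R.
Proof.
rewrite meval_pfam /axis; case: eqP => [->|_]; last by rewrite mul0r mulr0.
rewrite big1 => [|j /negPf ->]; last by rewrite expr0n.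
by rewrite expr1n; ring.
Qed.

Lemma meval_pfam_diag i j k : i != j ->
  (pfam k).@[fun l => axis i l + axis j l] = 2^-1 * ((k == i)%:R + (k == j)%:R).
Proof.
move=> ij; rewrite meval_pfam /axis.
have E (i' j' : 'I_4) : i' != j' ->
    \sum_(l | l != i') ((l == i')%:R + (l == j')%:R : R) ^+ 2 = 1.
  (* Off [i'], the only nonzero coordinate is the one at [j']. *)
  rewrite eq_sym => nij; rewrite (bigD1 j') //= eqxx (negPf nij) big1.
    by rewrite add0r expr1n addr0.
  by move=> l /andP[/negPf -> /negPf ->]; rewrite addr0 expr0n.
have [->|ki] := eqVneq k i; first by rewrite E // (negPf ij) /=; field.
have [kj|kj] := eqVneq k j; last by rewrite addr0 mul0r mulr0.
rewrite {k}kj in ki *.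
rewrite (eq_bigr (fun l => ((l == j)%:R + (l == i)%:R : R) ^+ 2)) => [|l _].
  by rewrite E //=; field.
by rewrite addrC.
Qed.

(** Coordinates with respect to the [pfam i]: at [axis i] only [pfam i] is
nonzero, with value 3 / 2. *)
Definition pcoord g (i : 'I_4) : R := 2 / 3 * g.@[axis i].

Lemma meval_pfam_comb (k : 'I_4 -> R) v :
  (\sum_i k i *: pfam i).@[v] = \sum_i k i * (pfam i).@[v].
Proof. by rewrite [meval _ _]raddf_sum; apply: eq_bigr => i _; apply: mevalZ. Qed.

Lemma pcoord_pfam_comb (k : 'I_4 -> R) i : pcoord (\sum_j k j *: pfam j) i = k i.
Proof.
rewrite /pcoord meval_pfam_comb (bigD1 i) //= big1 => [|j /negPf ji].
  by rewrite meval_pfam_axis eqxx /=; field.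
by rewrite meval_pfam_axis ji !mulr0.
Qed.

Lemma pfam_homog i : pfam i \is 3.-homog.
Proof.
have X2 j : ('X_j ^+ 2 : {mpoly R[4]}) \is 2.-homog.
  by rewrite mpolyXn dhomogX /= mdegMn mdeg1.
rewrite /pfam -[3%N]/(1 + 2)%N dhomogM //.
  by rewrite dhomogX /= mdeg1.
by rewrite rpredB ?rpredZ // rpred_sum.
Qed.

Lemma sum_sq_p_homog : sum_sq_p R \is (2 * 3)%N.-homog.
Proof.
by rewrite sum_sq_pE rpred_sum // => i _; exact: (dhomogMn 2 (pfam_homog i)).
Qed.

(** The nonnegative numbers [sep (g ^+ 2)], for [g] in [s], add up to
[sep (sum_sq_p R) = 0], so each of them vanishes. *)
Lemma sos_summand_pfam s : sos_decomposition (sum_sq_p R) s ->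
  {in s, forall g, g = \sum_i pcoord g i *: pfam i}.
Proof.
move=> sE; have hom := sos_summand_homog sum_sq_p_homog sE.
have := sep_sum_sq_p; rewrite sE sep_sum big_seq => /eqP.
rewrite psumr_eq0 => [/allP s0 g gs|g gs]; last exact/sep_sqr_ge0/hom.
have := s0 g gs; rewrite gs => /eqP/(sep_sqr_eq0 (hom g gs))[k gE].
by rewrite {1}gE; apply: eq_bigr => i _; rewrite gE pcoord_pfam_comb.
Qed.

(** The diagonal entries come from evaluation at the coordinate vectors; the
others by polarization from evaluation at their pairwise sums. *)
Lemma sos_pcoord_orthonormal s i j : sos_decomposition (sum_sq_p R) s ->
  \sum_(g <- s) pcoord g i * pcoord g j = (i == j)%:R.
Proof.
move=> sE.
have fv v : \sum_(g <- s) (g.@[v]) ^+ 2 = \sum_k ((pfam k).@[v]) ^+ 2.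
  have := congr1 (meval v) sE; rewrite sum_sq_pE !raddf_sum /= => E.
  by under eq_bigr do rewrite -rmorphXn /=; rewrite -E;
     apply: eq_bigr => k _; rewrite rmorphXn.
have norm l : \sum_(g <- s) pcoord g l ^+ 2 = 1.
  under eq_bigr do rewrite exprMn.
  rewrite -mulr_sumr fv (bigD1 l) //= big1 => [|k /negPf kl].
    by rewrite meval_pfam_axis eqxx /=; field.
  by rewrite meval_pfam_axis kl mulr0 expr0n.
have [<-|ij] := eqVneq i j; first by rewrite -[RHS](norm i).
have ji : j != i by rewrite eq_sym.
have diag : \sum_(g <- s) (pcoord g i + pcoord g j) ^+ 2 = 2.
  transitivity (\sum_(g <- s) 4 * (g.@[fun l => axis i l + axis j l]) ^+ 2).
    apply: eq_big_seq => g gs; rewrite {3}(sos_summand_pfam sE gs).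
    rewrite meval_pfam_comb (bigD1 i) // (bigD1 j) //= big1.
      by rewrite !meval_pfam_diag // !eqxx (negPf ij) (negPf ji) /=; field.
    by move=> k /= /andP[/negPf ki /negPf kj]; rewrite meval_pfam_diag //
       ki kj addr0 !mulr0.
  rewrite -mulr_sumr fv (bigD1 i) // (bigD1 j) //= big1.
    by rewrite !meval_pfam_diag // !eqxx (negPf ij) (negPf ji) /=; field.
  move=> k /= /andP[/negPf ki /negPf kj].
  by rewrite meval_pfam_diag // ki kj addr0 mulr0 expr0n.
have : \sum_(g <- s) (pcoord g i + pcoord g j) ^+ 2 =
    \sum_(g <- s) pcoord g i ^+ 2 + \sum_(g <- s) pcoord g j ^+ 2 +
    2 * \sum_(g <- s) pcoord g i * pcoord g j.
  rewrite mulr_sumr -!big_split /=.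
  by apply: eq_bigr => g _; ring.
by rewrite diag !norm /=; lra.
Qed.

(** * Uniqueness of decompositions and of the Gram matrix *)

Lemma sum_sq_p_sos : sos_decomposition (sum_sq_p R) (codom pfam).
Proof. by rewrite /sos_decomposition big_image sum_sq_pE. Qed.

Definition pcoord_mx N s : 'M[R]_(N, 4) := \matrix_(k, i) pcoord s`_k i.

Lemma pcoord0 i : pcoord 0 i = 0 :> R.
Proof. by rewrite /pcoord meval0 mulr0. Qed.

Lemma pad_vec_pcoord N s : sos_decomposition (sum_sq_p R) s ->
  pad_vec N s = map_mx (@mpolyC 4 R) (pcoord_mx N s) *m \col_i pfam i.
Proof.
move=> sE; apply/colP => k; rewrite !mxE.
under eq_bigr do rewrite !mxE mul_mpolyC.
have [ks|sk] := ltnP k (size s); first exact/(sos_summand_pfam sE)/mem_nth.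
by rewrite nth_default // big1 // => i _; rewrite pcoord0 scale0r.
Qed.

Lemma pcoord_mx_orthonormal N s :
  (size s <= N)%N -> sos_decomposition (sum_sq_p R) s ->
  (pcoord_mx N s)^T *m pcoord_mx N s = 1%:M.
Proof.
move=> sN sE; apply/matrixP => i j.
rewrite !mxE -(sos_pcoord_orthonormal i j sE) (big_nth 0) big_mkord.
rewrite [RHS](big_ord_widen _ (fun k => pcoord s`_k i * pcoord s`_k j) sN).
rewrite [RHS]big_mkcond /=; apply: eq_bigr => k _; rewrite !mxE.
by case: ltnP => // sk; rewrite nth_default // pcoord0 mul0r.
Qed.

Lemma sum_sq_p_unique_sos : unique_sos_mod_orthogonal (sum_sq_p R).
Proof.
split=> [|s t sE tE]; first by exists (codom pfam); exact: sum_sq_p_sos.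
pose n := maxn (size s) (size t).
have sn : (size s <= n)%N by exact: leq_maxl.
have tn : (size t <= n)%N by exact: leq_maxr.
have pad u : (size u <= n)%N -> pcoord_mx (n + 4) u = col_mx (pcoord_mx n u) 0.
  move=> un; apply/matrixP => k i; rewrite !mxE.
  case: splitP => j kj; rewrite !mxE kj //.
  by rewrite nth_default ?pcoord0 // (leq_trans un) ?leq_addr.
have [U UU UE] := orthogonal_transport (pcoord_mx_orthonormal sn sE)
  (pcoord_mx_orthonormal tn tE).
exists (n + 4)%N; split; [exact: leq_trans sn (leq_addr _ _)|
  exact: leq_trans tn (leq_addr _ _)|exists U => //].
rewrite !pad_vec_pcoord // mulmxA -map_mxM; congr (map_mx _ _ *m _).
by rewrite !pad // UE.
Qed.

Local Notation monoms := (@deg_monoms 4 3).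

Lemma monom_vecE (n d : nat) (g : {mpoly R[n]}) : g \is d.-homog ->
  g = \sum_(j < #|deg_monoms n d|) g@_(bmnm (enum_val j)) *: (monom_vec R n d) j 0.
Proof.
move=> ghom; apply/mpolyP => m; rewrite raddf_sum /=.
under eq_bigr do rewrite mxE mcoeffZ mcoeffX.
have [md|md] := eqVneq (mdeg m) d; last first.
  rewrite (dhomog_nemf_coeff ghom) // big1 // => j _.
  have := enum_valP j; rewrite inE => /eqP jd.
  by case: eqP => [E|_]; [rewrite -E jd eqxx in md | rewrite mulr0].
have lem : (mdeg m < d.+1)%N by rewrite md.
have mS : BMultinom lem \in deg_monoms n d by rewrite inE /= md.
rewrite (bigD1 (enum_rank_in mS (BMultinom lem))) //= enum_rankK_in //= eqxx mulr1.
rewrite big1 ?addr0 // => j jm; case: eqP => [E|_]; last by rewrite mulr0.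
case/eqP: jm; apply: enum_val_inj; rewrite enum_rankK_in //.
exact: val_inj.
Qed.

Definition pcoef_mx : 'M[R]_(4, #|monoms|) :=
  \matrix_(i, j) (pfam i)@_(bmnm (enum_val j)).

Lemma gram_factor_sum (k : nat) (B : 'M[R]_(k, #|monoms|)) :
  ((monom_vec R 4 3)^T *m map_mx (@mpolyC 4 R) (B^T *m B) *m monom_vec R 4 3) 0 0
  = \sum_i ((map_mx (@mpolyC 4 R) B *m monom_vec R 4 3) i 0) ^+ 2.
Proof.
rewrite map_mxM -map_trmx mulmxA -trmx_mul -mulmxA mxE.
by apply: eq_bigr => i _; rewrite mxE.
Qed.

Lemma pcoef_mx_monom_vec i :
  (map_mx (@mpolyC 4 R) pcoef_mx *m monom_vec R 4 3) i 0 = pfam i.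
Proof.
rewrite mxE [RHS](monom_vecE (pfam_homog i)); apply: eq_bigr => j _.
by rewrite 2!mxE mul_mpolyC.
Qed.

Lemma pcoef_gram : gram_spectrahedron (sum_sq_p R) (pcoef_mx^T *m pcoef_mx).
Proof.
split.
- by rewrite trmx_mul trmxK.
- move=> u; rewrite mulmxA -trmx_mul -mulmxA mxE.
  by apply: sumr_ge0 => i _; rewrite mxE -expr2 sqr_ge0.
rewrite gram_factor_sum sum_sq_pE.
by apply: eq_bigr => i _; rewrite pcoef_mx_monom_vec.
Qed.

(** A factorization [Q = B^T B] turns the rows of [B] into the summands of a
decomposition, so [B] is the orthonormal [A] times the coefficient matrix of
the [pfam i], and [A] cancels in [B^T B]. *)
Lemma gram_spectrahedron_eq (Q : 'M[R]_#|monoms|) :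
  gram_spectrahedron (sum_sq_p R) Q -> Q = pcoef_mx^T *m pcoef_mx.
Proof.
move=> [symQ psdQ fE]; have [B QE] := psd_factor symQ psdQ.
pose q i := (map_mx (@mpolyC 4 R) B *m monom_vec R 4 3) i 0.
have sE : sos_decomposition (sum_sq_p R) (codom q).
  by rewrite /sos_decomposition big_image fE QE gram_factor_sum.
have qB i j : (q i)@_(bmnm (enum_val j)) = B i j.
  rewrite /q mxE raddf_sum (bigD1 j) //= !mxE mcoeffCM mcoeffX eqxx mulr1.
  rewrite big1 ?addr0 // => l lj; rewrite !mxE mcoeffCM mcoeffX.
  by case: eqP => [/val_inj/enum_val_inj E|_]; [rewrite E eqxx in lj | rewrite mulr0].
clearbody q.
pose A : 'M[R]_(_, 4) := \matrix_(k, i) pcoord (q k) i.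
have BA : B = A *m pcoef_mx.
  apply/matrixP => k j; rewrite -qB (sos_summand_pfam sE (codom_f q k)).
  rewrite raddf_sum mxE; apply: eq_bigr => i _; by rewrite /= mcoeffZ !mxE.
have AA : A^T *m A = 1%:M.
  apply/matrixP => i j; rewrite !mxE -(sos_pcoord_orthonormal i j sE) big_image.
  by apply: eq_bigr => k _; rewrite !mxE.
by rewrite QE BA trmx_mul mulmxA -(mulmxA _ A^T) AA mulmx1.
Qed.

End Cubic.

Theorem proposition5p2 (R : realType) :
  (exists! Q : 'M[R]_#|deg_monoms 4 3|, gram_spectrahedron (sum_sq_p R) Q) /\
  unique_sos_mod_orthogonal (sum_sq_p R).
Proof.
split; last exact: sum_sq_p_unique_sos.
exists ((pcoef_mx R)^T *m pcoef_mx R); split; first exact: pcoef_gram.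
by move=> Q /gram_spectrahedron_eq ->.
Qed.
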